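(* Let $R_i$ be a ring for all $i\in\{1,\ldots,n\}$. The direct product $\prod_{i=1}^{n} R_i$ is strongly NUS-nil clean if and only if each direct component $R_i$ is strongly square-nil clean.
   Context: All rings are associative with identity, not necessarily commutative. An element $e$ of a ring $R$ is square-idempotent if $e^2=e^4$. An element $a\in R$ is strongly square-nil clean if $a=e+m$ with $e\in R$ square-idempotent, $m\in R$ nilpotent and $em=me$. A ring $R$ is strongly square-nil clean if every element of $R$ is strongly square-nil clean, and strongly NUS-nil clean if every non-invertible element of $R$ is strongly square-nil clean.
   Formalization: The product is assumed to have at least two factors (n ≥ 2) and each ring R_i to be nonzero; otherwise the claim fails, e.g. for the single ring F_5 (2 is not strongly square-nil clean) or for Q × 0. *)

(* Defs.v *)
From HB Require Import structures.
From mathcomp Require Import all_boot all_algebra.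

Set Implicit Arguments.
Unset Strict Implicit.
Unset Printing Implicit Defensive.

Import GRing.Theory.
Local Open Scope ring_scope.

Definition square_idempotent (R : pzRingType) (e : R) : Prop := e ^+ 2 = e ^+ 4.

Definition nilpotent_elt (R : pzRingType) (m : R) : Prop :=
  exists k : nat, m ^+ k = 0.

(* GRing.unit is available only on unitRingType; this is two-sided
   invertibility in an arbitrary, possibly noncommutative, ring. *)
Definition invertible (R : pzRingType) (a : R) : Prop :=
  exists b : R, b * a = 1 /\ a * b = 1.

Definition strongly_square_nil_clean_elt (R : pzRingType) (a : R) : Prop :=
  exists e m : R,
    [/\ a = e + m, square_idempotent e, nilpotent_elt m & e * m = m * e].

Definition strongly_square_nil_clean (R : pzRingType) : Prop :=
  forall a : R, strongly_square_nil_clean_elt a.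

Definition strongly_NUS_nil_clean (R : pzRingType) : Prop :=
  forall a : R, ~ invertible a -> strongly_square_nil_clean_elt a.

(* The library puts a ring structure on {ffun I -> R} for a constant R only,
   so the product of a family of possibly different rings is built here, as
   dependent finite functions with pointwise operations. *)
Definition ring_prod (n : nat) (R : 'I_n -> pzRingType) : Type :=
  {dffun forall i : 'I_n, R i}.

Section RingProd.
Variables (n : nat) (R : 'I_n -> pzRingType).

HB.instance Definition _ := Choice.copy (ring_prod R) {dffun forall i, R i}.

Implicit Types f g : ring_prod R.

Definition ring_prod_zero : ring_prod R := [ffun i => 0 : R i].
Definition ring_prod_opp f : ring_prod R := [ffun i => - f i : R i].
Definition ring_prod_add f g : ring_prod R := [ffun i => f i + g i : R i].
Definition ring_prod_one : ring_prod R := [ffun i => 1 : R i].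
Definition ring_prod_mul f g : ring_prod R := [ffun i => f i * g i : R i].

Fact ring_prod_addA : associative ring_prod_add.
Proof. by move=> f g h; apply/ffunP=> i; rewrite !ffunE addrA. Qed.
Fact ring_prod_addC : commutative ring_prod_add.
Proof. by move=> f g; apply/ffunP=> i; rewrite !ffunE addrC. Qed.
Fact ring_prod_add0 : left_id ring_prod_zero ring_prod_add.
Proof. by move=> f; apply/ffunP=> i; rewrite !ffunE add0r. Qed.
Fact ring_prod_addN : left_inverse ring_prod_zero ring_prod_opp ring_prod_add.
Proof. by move=> f; apply/ffunP=> i; rewrite !ffunE addNr. Qed.

HB.instance Definition _ := GRing.isZmodule.Build (ring_prod R)
  ring_prod_addA ring_prod_addC ring_prod_add0 ring_prod_addN.

Fact ring_prod_mulA : associative ring_prod_mul.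
Proof. by move=> f g h; apply/ffunP=> i; rewrite !ffunE mulrA. Qed.
Fact ring_prod_mul1l : left_id ring_prod_one ring_prod_mul.
Proof. by move=> f; apply/ffunP=> i; rewrite !ffunE mul1r. Qed.
Fact ring_prod_mul1r : right_id ring_prod_one ring_prod_mul.
Proof. by move=> f; apply/ffunP=> i; rewrite !ffunE mulr1. Qed.
Fact ring_prod_mulDl : left_distributive ring_prod_mul ring_prod_add.
Proof. by move=> f g h; apply/ffunP=> i; rewrite !ffunE mulrDl. Qed.
Fact ring_prod_mulDr : right_distributive ring_prod_mul ring_prod_add.
Proof. by move=> f g h; apply/ffunP=> i; rewrite !ffunE mulrDr. Qed.

HB.instance Definition _ := GRing.Zmodule_isPzRing.Build (ring_prod R)
  ring_prod_mulA ring_prod_mul1l ring_prod_mul1r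
  ring_prod_mulDl ring_prod_mulDr.

End RingProd.

(* Main.v *)
Require Import Defs.
From HB Require Import structures.
From mathcomp Require Import all_boot all_algebra.

(** The projections of a product ring are ring morphisms, and ring morphisms
    preserve both invertibility and strongly square-nil clean decompositions.

    Every [a] in [R i] is the [i]-th component of a non-invertible element of
    the product: extend [a] by zero. Since there is another index [j] and
    [R j] is nontrivial, an inverse would project to an inverse of 0 in [R j].
    So the decomposition that the product provides for the non-invertible
    extension projects to a decomposition of [a].

    Conversely, decompositions of the components assemble to a decomposition of
    the whole family ([strongly_square_nil_clean_elt_prod]): square-idempotency
    and commutation are checked componentwise, and finiteness of the index set
    gives a common nilpotency exponent. Hence every element of the product is
    strongly square-nil clean, in particular the non-invertible ones. *)

Set Implicit Arguments.
Unset Strict Implicit.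
Unset Printing Implicit Defensive.

Import GRing.Theory.
Local Open Scope ring_scope.

Section Morphism.
Variables (R S : pzRingType) (f : {rmorphism R -> S}).

Lemma rmorph_invertible (a : R) : invertible a -> invertible (f a).
Proof.
by case=> b [ba ab]; exists (f b); rewrite -!rmorphM ba ab !rmorph1.
Qed.

Lemma rmorph_strongly_square_nil_clean_elt (a : R) :
  strongly_square_nil_clean_elt a -> strongly_square_nil_clean_elt (f a).
Proof.
case=> e [m [-> ee [k mk] em]]; exists (f e), (f m); split.
- exact: rmorphD.
- by rewrite /square_idempotent -!rmorphXn ee.
- by exists k; rewrite -rmorphXn mk rmorph0.
- by rewrite -!rmorphM em.
Qed.

End Morphism.

Lemma invertible0 (R : nzRingType) : ~ invertible (0 : R).
Proof. by case=> b [_ /eqP]; rewrite mul0r eq_sym oner_eq0. Qed.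

Section Projection.
Variables (n : nat) (R : 'I_n -> pzRingType).

Definition ring_prod_proj (i : 'I_n) (f : ring_prod R) : R i := f i.

Fact ring_prod_proj_is_zmod_morphism i : zmod_morphism (ring_prod_proj i).
Proof. by move=> f g; rewrite /ring_prod_proj !ffunE. Qed.

Fact ring_prod_proj_is_monoid_morphism i : monoid_morphism (ring_prod_proj i).
Proof. by split=> [|f g]; rewrite /ring_prod_proj !ffunE. Qed.

HB.instance Definition _ i :=
  GRing.isZmodMorphism.Build (ring_prod R) (R i) (ring_prod_proj i)
    (ring_prod_proj_is_zmod_morphism i).
HB.instance Definition _ i :=
  GRing.isMonoidMorphism.Build (ring_prod R) (R i) (ring_prod_proj i)
    (ring_prod_proj_is_monoid_morphism i).

Lemma ring_prod_projP (f g : ring_prod R) :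
  (forall i, ring_prod_proj i f = ring_prod_proj i g) -> f = g.
Proof. by move=> fg; apply/ffunP. Qed.

(** As the index set is finite, the sum of the exponents that kill the
    components kills all of them at once. *)
Lemma nilpotent_elt_prod (f : ring_prod R) :
  (forall i, nilpotent_elt (ring_prod_proj i f)) -> nilpotent_elt f.
Proof.
move=> /fin_all_exists[k fk]; exists (\sum_i k i)%N.
apply: ring_prod_projP => i.
by rewrite rmorphXn rmorph0 (bigD1 i) //= exprD fk mul0r.
Qed.

Lemma strongly_square_nil_clean_elt_prod (f : ring_prod R) :
  (forall i, strongly_square_nil_clean_elt (ring_prod_proj i f)) ->
  strongly_square_nil_clean_elt f.
Proof.
move=> /fin_all_exists[e /fin_all_exists[m em]].
pose E : ring_prod R := [ffun i => e i]; pose M : ring_prod R := [ffun i => m i].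
have projE i : ring_prod_proj i E = e i by rewrite /ring_prod_proj ffunE.
have projM i : ring_prod_proj i M = m i by rewrite /ring_prod_proj ffunE.
exists E, M; split.
- by apply: ring_prod_projP => i; rewrite rmorphD /= projE projM; case: (em i).
- by apply: ring_prod_projP => i; rewrite !rmorphXn /= projE; case: (em i).
- by apply: nilpotent_elt_prod => i; rewrite projM; case: (em i).
- by apply: ring_prod_projP => i; rewrite !rmorphM /= projE projM; case: (em i).
Qed.

Definition ring_prod_inj (i : 'I_n) (a : R i) : ring_prod R :=
  [ffun j => dfwith (fun j => 0 : R j) a j].

Lemma ring_prod_proj_inj i (a : R i) :
  ring_prod_proj i (ring_prod_inj a) = a.
Proof. by rewrite /ring_prod_proj ffunE dfwith_in. Qed.

Lemma ring_prod_proj_inj_neq i j (a : R i) :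
  i != j -> ring_prod_proj j (ring_prod_inj a) = 0.
Proof. by move=> ij; rewrite /ring_prod_proj ffunE dfwith_out. Qed.

End Projection.

Lemma exists_ord_neq (n : nat) (i : 'I_n) : (1 < n)%N -> exists j, i != j.
Proof.
move=> n_gt1; have : (0 < #|predC1 i|)%N by rewrite cardC1 card_ord -subn1 subn_gt0.
by case/card_gt0P=> j ji; exists j; rewrite eq_sym.
Qed.

(** The zero that extension by zero puts at another index prevents
    invertibility. *)
Lemma ring_prod_inj_noninvertible (n : nat) (R : 'I_n -> nzRingType) (i : 'I_n)
    (a : R i) :
  (1 < n)%N -> ~ invertible (ring_prod_inj (R := fun i => R i) a).
Proof.
move=> /(exists_ord_neq i)[j ij] /(rmorph_invertible (ring_prod_proj j)) /=.
by rewrite ring_prod_proj_inj_neq //; apply: invertible0.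
Qed.

Local Close Scope ring_scope.

Theorem lemma2p4 (n : nat) (hn : 1 < n) (R : 'I_n -> nzRingType) :
  strongly_NUS_nil_clean (ring_prod (fun i : 'I_n => R i)) <->
  (forall i : 'I_n, strongly_square_nil_clean (R i)).
Proof.
split=> [cleanR i a | cleanR f _].
  have := cleanR _ (@ring_prod_inj_noninvertible n R i a hn).
  move=> /(rmorph_strongly_square_nil_clean_elt (ring_prod_proj i)) /=.
  by rewrite ring_prod_proj_inj.
by apply: strongly_square_nil_clean_elt_prod => i; apply: cleanR.
Qed.
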